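(* There is a connected $\mathrm{sum}$-DHN that expresses a value property definable by a first-order formula $\varphi(x)$ and that is not equivalent to any UNFOC formula (i.e. no UNFOC formula in one free variable accepts exactly the same pointed databases).
   Context: Databases. A schema $S$ is a finite set of relation symbols $R$ with arities $\mathrm{ar}(R)\ge 0$. An $S$-database $D$ is a finite set of facts $R(\bar v)$, $R\in S$, $\bar v$ an $\mathrm{ar}(R)$-tuple of values from a fixed countably infinite set; $\mathrm{adom}(D)$ is the set of values occurring in $D$. A pointed database $D^v$ is a database with $v\in\mathrm{adom}(D)$. A pattern $F$ is a database together with a finite set $\mathrm{adom}(F)$ of values containing all values occurring in its facts (isolated values allowed); $F^w$ is a pattern with distinguished $w\in\mathrm{adom}(F)$. $\mathrm{Hom}(F^w,D^u)$ is the set of maps $h:\mathrm{adom}(F)\to\mathrm{adom}(D)$ with $h(w)=u$ and $R(\bar v)\in F\Rightarrow R(h(\bar v))\in D$. sum-DHNs. A sum-homomorphism query of input dimension $d\ge 0$ and output dimension $d'>0$ is a pair $(F^w,\mu)$, $F^w$ a pointed pattern, $\mu$ assigning to each $v\in\mathrm{adom}(F)$ a transformation function $\mu_v:\mathbb R^d\to\mathbb R^{d'}$. On $D^u$ with embedding $\lambda:\mathrm{adom}(D)\to\mathbb R^d$ its result is $\sum_{h\in\mathrm{Hom}(F^w,D^u)}\prod_{v\in\mathrm{adom}(F)}\mu_v(\lambda(h(v)))$ (component-wise). It is connected if the graph on $\mathrm{adom}(F)$ with edges between distinct values occurring in a common fact is connected. A layer is a finite sequence of such queries of the same input dimension, with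 output dimensions $d_1,\dots,d_m$, and a combination function $\mathrm{com}:\mathbb R^{d_1}\times\dots\times\mathbb R^{d_m}\to\mathbb R^{d'}$; it maps $\lambda$ to the embedding sending $u$ to $\mathrm{com}$ applied to the results of the queries on $(D^u,\lambda)$. A sum-DHN over $S$ is a sequence $(\mathcal L_1,\dots,\mathcal L_k,\mathrm{cls})$ of layers with matching dimensions, input dimension of $\mathcal L_1$ equal to $0$, and a classification function $\mathrm{cls}:\mathbb R^{d'}\to\{0,1\}$; it is connected if all its queries are. Starting from the empty-vector embedding, apply the layers in order to get $\lambda^k$; the DHN accepts $D^v$ iff $\mathrm{cls}(\lambda^k(v))=1$, and expresses the set of pointed $S$-databases it accepts. UNFOC. $\varphi(\bar x)::=R(\bar x)\mid\varphi\wedge\varphi\mid\varphi\vee\varphi\mid\exists^{\ge n}y\,\varphi(\bar x,y)\mid\neg\varphi(x_i)$, $n\in\mathbb N$, where in the last clause $\varphi$ has no free variable besides possibly $x_i$ ($R(\bar x)$ is a relational atom; no equality atoms). Quantifiers range over $\mathrm{adom}(D)$. A formula $\varphi(x)$ accepts $D^v$ iff $D\models\varphi(v)$. *)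

(* Defs.v *)
From mathcomp Require Import all_boot all_order all_algebra.
From mathcomp Require Import finmap reals.

Set Implicit Arguments.
Unset Strict Implicit.
Unset Printing Implicit Defensive.

Local Open Scope fset_scope.

Record schema : Type := Schema { sym : finType; ar : sym -> nat }.

(* The fixed countably infinite set of values. *)
Notation value := nat (only parsing).

Definition fact (S : schema) : Type := {r : sym S & (ar r).-tuple value}.

Definition mkfact (S : schema) (r : sym S) (t : (ar r).-tuple value) : fact S :=
  Tagged (fun r : sym S => (ar r).-tuple value) t.

Definition fact_args (S : schema) (f : fact S) : seq value := tagged f.

Definition database (S : schema) : Type := {fset (fact S)}.

Definition adom (S : schema) (D : {fset (fact S)}) : {fset value} :=
  \bigcup_(f <- D) [fset x | x in fact_args f].

(* A pointed database is given by [D : database S] and [v : adom D]; a value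
   property is a set of pointed databases. *)
Definition value_property (S : schema) : Type :=
  forall D : database S, adom D -> Prop.

(* [padom F] may contain isolated values, occurring in no fact. *)
Record pattern (S : schema) : Type := Pattern {
  pfacts : {fset (fact S)};
  padom : {fset value};
  pfacts_padom : adom pfacts `<=` padom
}.

(* Since [padom F] contains all values occurring in the facts of [F], these
   facts are exactly the [mkfact (map_tuple val t)] in [pfacts F] with [t] a
   tuple over [padom F]. *)
Definition homs (S : schema) (F : pattern S) (w : padom F)
    (D : database S) (u : adom D) : {set {ffun padom F -> adom D}} :=
  [set h : {ffun padom F -> adom D} | (h w == u) &&
    [forall r : sym S, forall t : (ar r).-tuple (padom F),
      (mkfact (map_tuple val t) \in pfacts F) ==>
      (mkfact (map_tuple (fun v => val (h v)) t) \in D)]].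

Definition pattern_edge (S : schema) (F : pattern S) : rel (padom F) :=
  fun x y => (x != y) &&
    [exists f : pfacts F,
      (val x \in fact_args (val f)) && (val y \in fact_args (val f))].

Definition connected_pattern (S : schema) (F : pattern S) : Prop :=
  forall x y : padom F, connect (@pattern_edge S F) x y.

Section DHN.
Local Open Scope ring_scope.
Variables (R : realType) (S : schema).

Record sumhom_query (d d' : nat) : Type := SumHomQuery {
  out_gt0 : (0 < d')%N;
  qpat : pattern S;
  qpt : padom qpat;
  qtrans : padom qpat -> 'rV[R]_d -> 'rV[R]_d'
}.

(* Products and sums of vectors are taken component-wise. *)
Definition query_result d d' (Q : sumhom_query d d')
    (D : database S) (lam : adom D -> 'rV[R]_d) (u : adom D) : 'rV[R]_d' :=
  \row_(j < d') \sum_(h in homs (qpt Q) u)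
     \prod_(v : padom (qpat Q)) qtrans v (lam (h v)) 0 j.

Record layer (d d' : nat) : Type := Layer {
  lnum : nat;
  ldim : 'I_lnum -> nat;
  lquery : forall i : 'I_lnum, sumhom_query d (ldim i);
  lcom : (forall i : 'I_lnum, 'rV[R]_(ldim i)) -> 'rV[R]_d'
}.
Arguments lquery {d d'} L i : rename.
Arguments lcom {d d'} L r : rename.

Definition layer_apply d d' (L : layer d d')
    (D : database S) (lam : adom D -> 'rV[R]_d) : adom D -> 'rV[R]_d' :=
  fun u => lcom L (fun i => query_result (lquery L i) lam u).

Definition connected_layer d d' (L : layer d d') : Prop :=
  forall i : 'I_(lnum L), connected_pattern (qpat (lquery L i)).

(* Nonempty sequences of layers with matching dimensions. *)
Inductive layers : nat -> nat -> Type :=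
| LOne d d' : layer d d' -> layers d d'
| LCons d d' d'' : layer d d' -> layers d' d'' -> layers d d''.

Fixpoint layers_apply d d' (Ls : layers d d') (D : database S) :
    (adom D -> 'rV[R]_d) -> adom D -> 'rV[R]_d' :=
  match Ls in layers d d'
    return (adom D -> 'rV[R]_d) -> adom D -> 'rV[R]_d' with
  | LOne _ _ L => fun lam => layer_apply L lam
  | LCons _ _ _ L Ls' => fun lam => layers_apply Ls' (layer_apply L lam)
  end.

Fixpoint connected_layers d d' (Ls : layers d d') : Prop :=
  match Ls with
  | LOne _ _ L => connected_layer L
  | LCons _ _ _ L Ls' => connected_layer L /\ connected_layers Ls'
  end.

Record sumDHN : Type := SumDHN {
  dhn_dim : nat;
  dhn_layers : layers 0 dhn_dim;
  dhn_cls : 'rV[R]_dhn_dim -> bool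
}.

Definition connected_DHN (N : sumDHN) : Prop := connected_layers (dhn_layers N).

(* ['rV[R]_0] has the single element [0], the empty vector. *)
Definition DHN_accepts (N : sumDHN) (D : database S) (v : adom D) : bool :=
  dhn_cls (layers_apply (dhn_layers N) (fun _ : adom D => 0) v).

Definition DHN_expresses (N : sumDHN) (P : value_property S) : Prop :=
  forall (D : database S) (v : adom D), DHN_accepts N v <-> P D v.

End DHN.

Notation var := nat (only parsing).

(* Quantifiers range over the active domain. *)
Definition assignment (S : schema) (D : database S) : Type := var -> adom D.

Definition update (S : schema) (D : database S) (a : assignment D)
    (y : var) (v : adom D) : assignment D :=
  fun x => if x == y then v else a x.

Definition sat_atom (S : schema) (D : database S) (a : assignment D)
    (r : sym S) (xs : (ar r).-tuple var) : bool :=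
  mkfact (map_tuple (fun x => val (a x)) xs) \in D.

Section Formulas.
Variable S : schema.

Inductive FO : Type :=
| FOAtom (r : sym S) (xs : (ar r).-tuple var)
| FOEq (x y : var)
| FONot (phi : FO)
| FOAnd (phi psi : FO)
| FOOr (phi psi : FO)
| FOEx (y : var) (phi : FO)
| FOAll (y : var) (phi : FO).

Fixpoint FO_fv (phi : FO) : {fset var} :=
  match phi with
  | FOAtom _ xs => [fset x | x in tval xs]
  | FOEq x y => [fset x; y]
  | FONot phi => FO_fv phi
  | FOAnd phi psi | FOOr phi psi => FO_fv phi `|` FO_fv psi
  | FOEx y phi | FOAll y phi => FO_fv phi `\ y
  end.

Fixpoint FO_sat (D : database S) (a : assignment D) (phi : FO) : bool :=
  match phi with
  | FOAtom _ xs => sat_atom a xs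
  | FOEq x y => a x == a y
  | FONot phi => ~~ FO_sat a phi
  | FOAnd phi psi => FO_sat a phi && FO_sat a psi
  | FOOr phi psi => FO_sat a phi || FO_sat a psi
  | FOEx y phi => [exists v : adom D, FO_sat (update a y v) phi]
  | FOAll y phi => [forall v : adom D, FO_sat (update a y v) phi]
  end.

(* [phi] is read as [phi(x)]; as [x] is its only possible free variable, [v] can
   be assigned to all variables. *)
Definition FO_defines (x : var) (phi : FO) (P : value_property S) : Prop :=
  FO_fv phi `<=` [fset x] /\
  forall (D : database S) (v : adom D), FO_sat (fun=> v) phi <-> P D v.

(* Raw syntax: [is_UNFOC] below imposes the restriction on negation. *)
Inductive UNFOC_pre : Type :=
| UAtom (r : sym S) (xs : (ar r).-tuple var)
| UAnd (phi psi : UNFOC_pre)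
| UOr (phi psi : UNFOC_pre)
| UExGe (n : nat) (y : var) (phi : UNFOC_pre)
| UNot (phi : UNFOC_pre).

Fixpoint UNFOC_fv (phi : UNFOC_pre) : {fset var} :=
  match phi with
  | UAtom _ xs => [fset x | x in tval xs]
  | UAnd phi psi | UOr phi psi => UNFOC_fv phi `|` UNFOC_fv psi
  | UExGe _ y phi => UNFOC_fv phi `\ y
  | UNot phi => UNFOC_fv phi
  end.

Fixpoint is_UNFOC (phi : UNFOC_pre) : Prop :=
  match phi with
  | UAtom _ _ => True
  | UAnd phi psi | UOr phi psi => is_UNFOC phi /\ is_UNFOC psi
  | UExGe _ _ phi => is_UNFOC phi
  | UNot phi => is_UNFOC phi /\ exists x : var, UNFOC_fv phi `<=` [fset x]
  end.

Fixpoint UNFOC_sat (D : database S) (a : assignment D) (phi : UNFOC_pre) : bool :=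
  match phi with
  | UAtom _ xs => sat_atom a xs
  | UAnd phi psi => UNFOC_sat a phi && UNFOC_sat a psi
  | UOr phi psi => UNFOC_sat a phi || UNFOC_sat a psi
  | UExGe n y phi => n <= #|[set v : adom D | UNFOC_sat (update a y v) phi]|
  | UNot phi => ~~ UNFOC_sat a phi
  end.

Definition UNFOC_defines (x : var) (phi : UNFOC_pre) (P : value_property S) : Prop :=
  [/\ is_UNFOC phi, UNFOC_fv phi `<=` [fset x] &
    forall (D : database S) (v : adom D), UNFOC_sat (fun=> v) phi <-> P D v].

End Formulas.

(* Main.v *)
(** The query asks that every successor of [x] be a predecessor of [x]. It is
    the equality of the numbers of homomorphisms from the patterns [E(w,y)] and
    [E(w,y), E(y,w)], the latter being among the former. It is not in UNFOC: if
    the only facts missing from a large complete database mention both [p] and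
    [q], then every formula has the truth value it has when all atoms are true,
    provided its free variables are not assigned both [p] and [q], which is
    automatic for the unary formulas to which negation applies. So no UNFOC
    formula separates a sufficiently large complete digraph from the same
    digraph without the edge [(0,1)], in which the query fails at [1]. *)
Require Import Defs.
From mathcomp Require Import all_boot all_order all_algebra.
From mathcomp Require Import finmap reals.

Set Implicit Arguments.
Unset Strict Implicit.
Unset Printing Implicit Defensive.

Import GRing.Theory Num.Theory.

Local Open Scope fset_scope.

(** * UNFOC formulas on databases that miss only facts mentioning two fixed values *)

Section NearlyComplete.
Variable S : schema.

Fixpoint UNFOC_bound (phi : UNFOC_pre S) : nat :=
  match phi with
  | UAtom _ _ => 0
  | UAnd phi psi | UOr phi psi => maxn (UNFOC_bound phi) (UNFOC_bound psi)
  | UExGe n _ phi => maxn n (UNFOC_bound phi)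
  | UNot phi => UNFOC_bound phi
  end.

(* Truth in an infinite database containing all facts. *)
Fixpoint UNFOC_full (phi : UNFOC_pre S) : bool :=
  match phi with
  | UAtom _ _ => true
  | UAnd phi psi => UNFOC_full phi && UNFOC_full psi
  | UOr phi psi => UNFOC_full phi || UNFOC_full psi
  | UExGe n _ phi => (n == 0) || UNFOC_full phi
  | UNot phi => ~~ UNFOC_full phi
  end.

Variables (D : database S) (p q : adom D).
Hypothesis neq_pq : p != q.
Hypothesis nearly_complete : forall r (t : (ar r).-tuple (adom D)),
  (p \notin t) || (q \notin t) -> mkfact (map_tuple val t) \in D.

(** One of the two values must be missed by all of [X]: this is what [nearly_complete] needs to make
    an atom over the variables [X] true. *)
Definition avoids (a : assignment D) (X : {fset nat}) : Prop :=
  (forall x, x \in X -> a x != p) \/ (forall x, x \in X -> a x != q).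

Lemma avoidsS a X Y : X `<=` Y -> avoids a Y -> avoids a X.
Proof.
by move=> /fsubsetP sXY [av|av]; [left|right] => x /sXY; apply: av.
Qed.

(** A single variable cannot take two distinct values; this settles negation. *)
Lemma avoids1 a x : avoids a [fset x].
Proof.
case: (eqVneq (a x) p) => [axp|axp]; last first.
  by left=> z; rewrite inE => /eqP->.
by right=> z; rewrite inE => /eqP->; rewrite axp.
Qed.

Lemma avoids_update a y v X :
  v != p -> v != q -> avoids a (X `\ y) -> avoids (update a y v) X.
Proof.
move=> vp vq [av|av]; [left|right] => x xX; rewrite /update;
  by case: (eqVneq x y) => // xy; apply: av; rewrite in_fsetD1 xy.
Qed.

(** Both implications go through one induction because negation exchanges them. The first must hold
    without avoidance, since the witness of a quantifier may be [p] or [q]. For the second,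
    witnesses are taken outside [p] and [q], which keeps avoidance intact. *)
Lemma UNFOC_nearly_complete (phi : UNFOC_pre S) (a : assignment D) :
    is_UNFOC phi -> (UNFOC_bound phi).+2 <= #|{: adom D}| ->
  (UNFOC_sat a phi -> UNFOC_full phi) /\
  (avoids a (UNFOC_fv phi) -> UNFOC_full phi -> UNFOC_sat a phi).
Proof.
elim: phi a => [r xs|phi IH psi IH'|phi IH psi IH'|n y phi IH|phi IH] a /=.
- move=> _ _; split=> // av _; rewrite /sat_atom.
  have -> : map_tuple (fun x => val (a x)) xs = map_tuple val (map_tuple a xs).
    by apply: val_inj; rewrite /= -map_comp.
  apply: nearly_complete; apply/orP.
  by case: av => av; [left|right]; apply/mapP=> -[x xxs e];
    have := av x; rewrite inE /= => /(_ xxs); rewrite -e eqxx.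
- move=> [U U']; rewrite -maxnSS -maxnSS geq_max => /andP[B B'].
  have [s1 s2] := IH a U B; have [t1 t2] := IH' a U' B'.
  split=> [/andP[/s1-> /t1->]//|av /andP[f f']].
  by rewrite s2 ?t2 //; apply: avoidsS av; rewrite ?fsubsetUl ?fsubsetUr.
- move=> [U U']; rewrite -maxnSS -maxnSS geq_max => /andP[B B'].
  have [s1 s2] := IH a U B; have [t1 t2] := IH' a U' B'.
  split=> [/orP[/s1->|/t1->]//|av /orP[f|f]]; rewrite ?orbT //.
    by rewrite s2 //; apply: avoidsS av; rewrite fsubsetUl.
  by rewrite t2 ?orbT //; apply: avoidsS av; rewrite fsubsetUr.
- move=> U; rewrite -maxnSS -maxnSS geq_max => /andP[B B'].
  split=> [|av /orP[/eqP->//|f]].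
    case: n B => // n _; case: (set_0Vmem [set v | UNFOC_sat (update a y v) phi]).
      by move=> ->; rewrite cards0.
    by move=> [v]; rewrite inE => /(proj1 (IH _ U B')).
  (* The [.+2] in the bound pays for excluding [p] and [q]: at least [n] witnesses remain. *)
  have ge_n : n <= #|~: [set p; q]|.
    by rewrite -(leq_add2l #|[set p; q]|) cardsC cards2 neq_pq add2n.
  apply: leq_trans ge_n _; apply/subset_leq_card/subsetP => v.
  rewrite !inE negb_or => /andP[vp vq].
  by apply: (proj2 (IH _ U B')) => //; apply: avoids_update.
- move=> [U [x sx]] B; have [s1 s2] := IH a U B.
  (* After contraposition, the implication that needs avoidance gets it from the single free
     variable. *)
  split=> [|_]; apply: contra => // f.
  by apply: s2 => //; apply: avoidsS sx (avoids1 a x).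
Qed.

End NearlyComplete.

(** * Directed graphs as databases over one binary symbol *)

Definition digraph_schema : schema := @Schema unit (fun _ => 2).

Definition edge (x y : nat) : fact digraph_schema :=
  @mkfact digraph_schema tt [tuple x; y].

Lemma edge_inj x y x' y' : edge x y = edge x' y' -> x = x' /\ y = y'.
Proof. by move=> /(congr1 (@fact_args _)) [-> ->]. Qed.

Lemma mkfact_edge (T : Type) (f : T -> nat) (r : sym digraph_schema)
    (t : (ar r).-tuple T) :
  exists x y, tval t = [:: x; y] /\ mkfact (map_tuple f t) = edge (f x) (f y).
Proof.
case: r t => -[[|x [|y [|]]] //= szt]; exists x, y; split=> //.
by congr mkfact; apply: val_inj.
Qed.

Lemma in_adom (S : schema) (D : database S) x :
  reflect (exists2 f, f \in D & x \in fact_args f) (x \in adom D).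
Proof.
apply: (iffP (bigfcupP _ _ _ _)) => -[f].
  by rewrite andbT => fD; rewrite inE => xf; exists f.
by move=> fD xf; exists f; rewrite ?andbT // inE.
Qed.

Lemma in_homs_digraph (F : pattern digraph_schema) (w : padom F)
    (D : database digraph_schema) (u : adom D) (h : {ffun padom F -> adom D}) :
  (h \in homs w u) <-> h w = u /\
    forall x y : padom F, edge (val x) (val y) \in pfacts F ->
      edge (val (h x)) (val (h y)) \in D.
Proof.
rewrite inE; split=> [/andP[/eqP hw /forallP/(_ tt)/forallP hF]|[-> hF]].
  split=> // x y xyF; have := hF [tuple x; y].
  rewrite (_ : map_tuple _ _ = [tuple val x; val y]); last exact: val_inj.
  rewrite (_ : map_tuple _ _ = [tuple val (h x); val (h y)]); last exact: val_inj.
  by move/implyP; apply.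
rewrite eqxx; apply/forallP=> r; apply/forallP=> t; apply/implyP.
have [x [y [et ->]]] := mkfact_edge val t.
have [x' [y' [et' ->]]] := mkfact_edge (fun v => val (h v)) t.
by move: et'; rewrite et => -[<- <-]; apply: hF.
Qed.

(** * The two patterns, without and with the back edge, and their homomorphisms *)

Definition out_facts (b : bool) : database digraph_schema :=
  if b then [fset edge 0 1; edge 1 0] else [fset edge 0 1].

Lemma in_out_facts b x y :
  (edge x y \in out_facts b) = (x == 0) && (y == 1) || [&& b, x == 1 & y == 0].
Proof.
have eqE i j : (edge x y == edge i j) = (x == i) && (y == j).
  by apply/eqP/andP => [/edge_inj[-> ->]|[/eqP-> /eqP->]].
by rewrite /out_facts; case: b; rewrite !inE !eqE ?orbF.
Qed.

Lemma out_facts_padom b : adom (out_facts b) `<=` [fset 0; 1].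
Proof.
apply/fsubsetP => x /in_adom[f]; rewrite /out_facts.
by case: b; rewrite !inE; [case/orP|]; move/eqP->; rewrite !inE // orbC.
Qed.

(** Both patterns have the values [0] and [1], so their homomorphisms have the same type and can be
    compared as sets. *)
Definition out_pattern (b : bool) : pattern digraph_schema :=
  Pattern (out_facts_padom b).

Definition out_root (b : bool) : padom (out_pattern b) := [` fset21 0 1].
Definition out_leaf (b : bool) : padom (out_pattern b) := [` fset22 0 1].

Lemma out_patternP b (x : padom (out_pattern b)) :
  x = out_root b \/ x = out_leaf b.
Proof.
by have := valP x; rewrite /= !inE => /orP[] /eqP e; [left|right]; apply: val_inj.
Qed.

Lemma out_pattern_connected b : connected_pattern (out_pattern b).
Proof.
have e01 : edge 0 1 \in out_facts b by rewrite in_out_facts.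
have rl : pattern_edge (out_root b) (out_leaf b).
  by apply/andP; split=> //; apply/existsP; exists [` e01].
have lr : pattern_edge (out_leaf b) (out_root b).
  by apply/andP; split=> //; apply/existsP; exists [` e01].
move=> x y.
by case: (out_patternP x) => ->; case: (out_patternP y) => ->;
  rewrite ?connect0 ?connect1.
Qed.

Lemma in_homs_out b (D : database digraph_schema) (u : adom D)
    (h : {ffun padom (out_pattern b) -> adom D}) :
  (h \in homs (out_root b) u) <->
  [/\ h (out_root b) = u, edge (val u) (val (h (out_leaf b))) \in D &
      b -> edge (val (h (out_leaf b))) (val u) \in D].
Proof.
rewrite in_homs_digraph; split=> [[hw hF]|[hw hrl hlr]].
  by split=> // [|bT]; rewrite -hw; apply: hF; rewrite in_out_facts //= bT.
split=> // x y; rewrite /= in_out_facts.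
by case: (out_patternP x) => ->; case: (out_patternP y) => -> //=;
  rewrite ?andbF ?andbT ?hw.
Qed.

Definition succ_sub_pred : value_property digraph_schema :=
  fun D v => forall y : adom D, edge (val v) (val y) \in D -> edge (val y) (val v) \in D.

(** The homomorphisms that respect the back edge are among those of the single edge, so equal
    cardinalities of these finite sets mean equal sets. *)
Lemma card_homs_out (D : database digraph_schema) (u : adom D) :
  #|homs (out_root true) u| = #|homs (out_root false) u| <-> succ_sub_pred u.
Proof.
have sub : homs (out_root true) u \subset homs (out_root false) u.
  by apply/subsetP => h /(@in_homs_out true)[hw h1 _]; apply/(@in_homs_out false).
split=> [/eqP|P].
  rewrite (subset_leqif_cards sub).2 => /eqP/setP eqh y uy.
  (* The homomorphism with root [u] and leaf [y]; by equality of the sets it also respects the back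
     edge. *)
  pose h : {ffun padom (out_pattern false) -> adom D} :=
    [ffun x => if val x == 0 then u else y].
  have : h \in homs (out_root false) u by apply/(@in_homs_out false); rewrite /h !ffunE.
  by rewrite -eqh => /(@in_homs_out true)[_ _]; rewrite /h !ffunE; apply.
apply/eqP; rewrite (subset_leqif_cards sub).2 eqEsubset sub.
by apply/subsetP => h /(@in_homs_out false)[hw h1 _]; apply/(@in_homs_out true); split=> // _; apply: P.
Qed.

(** * A one-layer network comparing the two homomorphism counts *)

Section Network.
Local Open Scope ring_scope.
Variable R : realType.

Definition out_query (b : bool) : sumhom_query R digraph_schema 0 1 :=
  @SumHomQuery R digraph_schema 0 1 isT (out_pattern b) (out_root b)
    (fun _ _ => const_mx 1).

(** With all transformation functions constantly [1], each homomorphism contributes [1] to the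
    sum. *)
Lemma query_result_out b (D : database digraph_schema)
    (lam : adom D -> 'rV[R]_0) (u : adom D) :
  query_result (out_query b) lam u = const_mx #|homs (out_root b) u|%:R.
Proof.
apply/rowP => j; rewrite mxE [RHS]mxE -sumr_const; apply: eq_bigr => h _.
by rewrite big1 // => v _; rewrite mxE.
Qed.

(** Index [ord0] carries the pattern with the back edge, [ord_max] the one without; the difference
    vanishes exactly when the counts agree. *)
Definition out_layer : layer R digraph_schema 0 1 :=
  @Layer R digraph_schema 0 1 2 (fun=> 1) (fun i => out_query (i == ord0))
    (fun r => r ord0 - r ord_max).

Definition out_DHN : sumDHN R digraph_schema :=
  SumDHN (LOne out_layer) (fun x => x 0 0 == 0).

Lemma out_DHN_connected : connected_DHN out_DHN.
Proof. by move=> i; apply: out_pattern_connected. Qed.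

Lemma out_DHN_expresses : DHN_expresses out_DHN succ_sub_pred.
Proof.
move=> D v; rewrite -card_homs_out.
rewrite /DHN_accepts /= /layer_apply /= !query_result_out !mxE subr_eq0 eqr_nat.
by split=> /eqP.
Qed.

End Network.

(** * First-order definability of the property *)

Definition succ_sub_pred_FO : FO digraph_schema :=
  FOAll 1 (FOOr (FONot (@FOAtom digraph_schema tt [tuple 0; 1]))
                (@FOAtom digraph_schema tt [tuple 1; 0])).

Lemma succ_sub_pred_FO_defines : FO_defines 0 succ_sub_pred_FO succ_sub_pred.
Proof.
split; first by apply/fsubsetP => x; rewrite !inE; case: eqP; rewrite /= ?orbF ?orbb.
have satE (D : database digraph_schema) (a : assignment D) x y :
    @sat_atom _ _ a tt [tuple x; y] = (edge (val (a x)) (val (a y)) \in D).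
  by rewrite /sat_atom /edge; congr (mkfact _ \in D); apply: val_inj.
move=> D v; split=> [/forallP sat y vy|P].
  by have := sat y; rewrite /= !satE /update /= vy.
by apply/forallP => y; rewrite /= !satE /update /= -implybE; apply/implyP/P.
Qed.

(** * Complete and punctured digraphs, which no UNFOC formula of small bound separates *)

Definition complete_digraph (n : nat) : database digraph_schema :=
  [fset f in [seq edge x y | x <- iota 0 n, y <- iota 0 n]].

Lemma in_complete_digraph n x y :
  (edge x y \in complete_digraph n) = (x < n) && (y < n).
Proof.
rewrite inE /=; apply/allpairsP/andP => [[[x' y'] /= [xn yn]]|[xn yn]].
  by move/edge_inj => -[-> ->]; rewrite !mem_iota in xn yn.
by exists (x, y); rewrite !mem_iota.
Qed.

Definition punctured_digraph (n : nat) : database digraph_schema :=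
  complete_digraph n `\ edge 0 1.

Lemma in_punctured_digraph n x y :
  (edge x y \in punctured_digraph n) =
  [&& (x != 0) || (y != 1), x < n & y < n].
Proof.
rewrite in_fsetD1 in_complete_digraph -negb_and; congr (~~ _ && _).
by apply/eqP/andP => [/edge_inj[-> ->]|[/eqP-> /eqP->]].
Qed.

Lemma adom_complete_digraph n : adom (complete_digraph n) = [fset x in iota 0 n].
Proof.
apply/fsetP => x; rewrite !inE mem_iota /=; apply/in_adom/idP => [[f]|xn].
  rewrite inE => /allpairsP[[y z] /= [yn zn ->]].
  by rewrite !mem_iota !inE in yn zn * => /orP[]/eqP->.
by exists (edge x x); rewrite ?in_complete_digraph ?xn // !inE eqxx.
Qed.

(** Loops survive the deletion, so no value is lost. *)
Lemma adom_punctured_digraph n : adom (punctured_digraph n) = [fset x in iota 0 n].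
Proof.
rewrite -adom_complete_digraph; apply/fsetP => x; apply/in_adom/idP => [[f]|].
  by rewrite in_fsetD1 => /andP[_ fD] xf; apply/in_adom; exists f.
rewrite adom_complete_digraph inE mem_iota /= => xn.
exists (edge x x); last by rewrite !inE eqxx.
by rewrite in_punctured_digraph xn -negb_and; case: x {xn} => [|[]].
Qed.

(** The hypotheses on [D] fit both digraphs, so both give [psi] the same truth value. *)
Lemma UNFOC_sat_digraph (D : database digraph_schema) n z0
    (psi : UNFOC_pre digraph_schema) (v : adom D) :
    (UNFOC_bound psi).+2 <= n -> adom D = [fset x in iota 0 n] ->
    (forall x y, x < n -> y < n -> edge x y != edge 0 1 -> edge x y \in D) ->
    is_UNFOC psi -> UNFOC_fv psi `<=` [fset z0] ->
  UNFOC_sat (fun=> v) psi = UNFOC_full psi.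
Proof.
move=> bound_n adomD fullD U fv; have n_gt1 : 1 < n by apply: leq_trans bound_n.
have in_adomD y : (y \in adom D) = (y < n) by rewrite adomD inE mem_iota.
have D0 : 0 \in adom D by rewrite in_adomD ltnW.
have D1 : 1 \in adom D by rewrite in_adomD.
have ncD r (t : (ar r).-tuple (adom D)) :
    ([` D0] \notin t) || ([` D1] \notin t) -> mkfact (map_tuple val t) \in D.
  have [y [z [et ->]]] := mkfact_edge val t.
  rewrite !memtE et => avoid.
  apply: fullD; rewrite -?in_adomD ?fsvalP //.
  (* Only the edge from [0] to [1] may be missing, and it mentions both excluded values. *)
  apply: contraTneq avoid => /edge_inj[y0 z1].
  have -> : y = [` D0] by apply: val_inj.
  have -> : z = [` D1] by apply: val_inj.
  by rewrite !inE !eqxx orbT.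
have card_D : (UNFOC_bound psi).+2 <= #|{: adom D}|.
  by rewrite -cardfE adomD card_fseq undup_id ?iota_uniq ?size_iota.
have [s1 s2] := @UNFOC_nearly_complete _ D [` D0] [` D1] isT ncD psi (fun=> v) U card_D.
apply/idP/idP => // f; apply: s2 => //.
by apply: avoidsS fv _; apply: avoids1.
Qed.

Lemma succ_sub_pred_not_UNFOC x psi : ~ UNFOC_defines x psi succ_sub_pred.
Proof.
move=> [U fv sat]; pose n := (UNFOC_bound psi).+2.
have c1 : 1 \in adom (complete_digraph n) by rewrite adom_complete_digraph !inE.
have p1 : 1 \in adom (punctured_digraph n) by rewrite adom_punctured_digraph !inE.
have p0 : 0 \in adom (punctured_digraph n) by rewrite adom_punctured_digraph !inE.
have full_psi : UNFOC_full psi.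
  rewrite -(@UNFOC_sat_digraph _ n x psi [` c1]) ?adom_complete_digraph //.
    by apply/sat => y; rewrite !in_complete_digraph andbC.
  by move=> y z yn zn _; rewrite in_complete_digraph yn.
have /sat : UNFOC_sat (fun=> [` p1]) psi.
  rewrite (@UNFOC_sat_digraph _ n x) ?adom_punctured_digraph //.
  by move=> y z yn zn yz; rewrite in_fsetD1 yz in_complete_digraph yn.
(* The value [0] is still a successor of [1], but no longer a predecessor. *)
by move=> /(_ [` p0]); rewrite !in_punctured_digraph /= => /(_ isT).
Qed.

Theorem proposition8 (R : realType) :
  exists (S : schema) (N : sumDHN R S) (P : value_property S),
    [/\ connected_DHN N,
        DHN_expresses N P,
        (exists (x : var) (phi : FO S), FO_defines x phi P) &
        ~ (exists (x : var) (psi : UNFOC_pre S),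
             UNFOC_defines x psi (fun D v => DHN_accepts N v))].
Proof.
exists digraph_schema, (out_DHN R), succ_sub_pred; split.
- exact: out_DHN_connected.
- exact: out_DHN_expresses.
- by exists 0, succ_sub_pred_FO; apply: succ_sub_pred_FO_defines.
- move=> [x [psi [U fv sat]]]; apply: (@succ_sub_pred_not_UNFOC x psi).
  by split=> // D v; rewrite sat; apply: out_DHN_expresses.
Qed.
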